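(* Let $F=F_{[a_1,b_1]}\cdots F_{[a_m,b_m]}$ be a star network of order $n$ with interior vertices $x_1,\dots,x_m$. If for some $v\in\mathfrak S_n$ and $d\ge1$ the set $\Pi_{v,d}(F)$ is nonempty, then the sets $\Pi_{v,0}(F),\dots,\Pi_{v,d-1}(F)$ are also nonempty.
   Context: A planar network of order $n$ is a directed, planar, acyclic multigraph embedded in the plane with $n$ source vertices on the left and $n$ sink vertices on the right, each labeled $1,\dots,n$ from bottom to top; edges may carry a positive integer multiplicity. For an interval $[a,b]\subseteq[n]$ (possibly empty), the simple star network $F_{[a,b]}$ has one interior vertex $x$, edges source $i\to x$ and $x\to$ sink $i$ for $i\in[a,b]$, and an edge source $i\to$ sink $i$ for $i\notin[a,b]$. The concatenation $E\circ F$ is obtained by deleting sink $i$ of $E$ and source $i$ of $F$ for each $i$ and merging each edge of $E$ ending at sink $i$ with each edge of $F$ starting at source $i$ into one edge. The condensed concatenation $E\bullet F$ is obtained from $E\circ F$ by replacing, for each pair of interior vertices joined by $p>1$ parallel edges, these edges by a single edge of multiplicity $p$. A star network $F=F_{[a_1,b_1]}\cdots F_{[a_m,b_m]}$ is any network built from $F_{[a_1,b_1]},\dots,F_{[a_m,b_m]}$ (in this order) by any combination of concatenations and condensed concatenations; its interior vertices are $x_1,\dots,x_m$, $x_j$ coming from $F_{[a_j,b_j]}$. A path family of type $v\in\mathfrak S_n$ is a sequence $\pi=(\pi_1,\dots,\pi_n)$ of source-to-sink paths with $\pi_i$ from source $i$ to sink $v_i$; it covers $F$ if each edge of multiplicity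 $p$ lies on exactly $p$ of the paths. $\Pi(F)$ is the set of covering path families, $\Pi_v(F)$ those of type $v$. The intersection of two paths has components that are single vertices or paths $(x_k,\dots,x_\ell)$; the two paths meet at the initial vertex $x_k$ of each component, and the component is a crossing if the paths enter $x_k$ and exit $x_\ell$ in different vertical orders (in the planar embedding). A defect of $\pi\in\Pi(F)$ at $x_k$ is a triple $(\pi_i,\pi_j,k)$ with $i<j$ such that $\pi_i,\pi_j$ meet at $x_k$ after having crossed an odd number of times; $\mathrm{dfct}(\pi)$ is the number of defects and $\Pi_{v,d}(F)=\{\pi\in\Pi_v(F):\mathrm{dfct}(\pi)=d\}$. *)

(* Defs.v *)
From HB Require Import structures.
From mathcomp Require Import all_boot all_fingroup.

Set Implicit Arguments.
Unset Strict Implicit.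
Unset Printing Implicit Defensive.

(** Labels 1, ..., n of the sources and sinks are represented by 'I_n, that is
    by 0, ..., n-1; interior vertices x_1, ..., x_m by Inner 0, ..., Inner m-1. *)

Inductive vertex (n : nat) : Type :=
  | Source of 'I_n
  | Inner of nat
  | Sink of 'I_n.
Arguments Inner {n} _.

Definition vertex_code n (x : vertex n) : 'I_n + (nat + 'I_n) :=
  match x with
  | Source i => inl i
  | Inner k => inr (inl k)
  | Sink i => inr (inr i)
  end.

Definition vertex_decode n (c : 'I_n + (nat + 'I_n)) : vertex n :=
  match c with
  | inl i => Source i
  | inr (inl k) => Inner k
  | inr (inr i) => Sink i
  end.

Lemma vertex_codeK n : cancel (@vertex_code n) (@vertex_decode n).
Proof. by case. Qed.

HB.instance Definition _ n := Equality.copy (vertex n) (can_type (@vertex_codeK n)).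

(** The planar embedding is recorded by wires.  In the standard drawing, every
    edge of a simple star network lies on one of n horizontal wires, numbered
    from bottom to top, which are pinched together at the interior vertices;
    concatenation glues wire i to wire i.  The vertical order of two edges
    entering (or leaving) the same vertex is the order of their wires, and
    parallel edges are distinguished by their wires. *)
Record edge (n : nat) : Type := Edge {
  edge_tail : vertex n;
  edge_head : vertex n;
  wire : 'I_n;
  mult : nat
}.

Definition edge_code n (e : edge n) : vertex n * vertex n * 'I_n * nat :=
  (edge_tail e, edge_head e, wire e, mult e).

Definition edge_decode n (c : vertex n * vertex n * 'I_n * nat) : edge n :=
  Edge c.1.1.1 c.1.1.2 c.1.2 c.2.

Lemma edge_codeK n : cancel (@edge_code n) (@edge_decode n).
Proof. by case. Qed.

HB.instance Definition _ n := Equality.copy (edge n) (can_type (@edge_codeK n)).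

Record network (n : nat) : Type := Network {
  inner_count : nat;
  edges : seq (edge n)
}.

(** An interval [a,b] of positive integers is the pair (a, b) and is empty when
    b < a; the element of 'I_n with value i carries the label i.+1. *)
Definition subinterval (n : nat) (ab : nat * nat) : bool :=
  (ab.2 < ab.1) || (0 < ab.1) && (ab.2 <= n).

Definition in_interval (n : nat) (ab : nat * nat) (i : 'I_n) : bool :=
  ab.1 <= i.+1 <= ab.2.

Definition simple_star (n : nat) (ab : nat * nat) : network n :=
  Network 1
    ([seq Edge (Source i) (Inner 0) i 1 | i <- enum 'I_n & in_interval ab i] ++
     [seq Edge (Inner 0) (Sink i) i 1 | i <- enum 'I_n & in_interval ab i] ++
     [seq Edge (Source i) (Sink i) i 1 | i <- enum 'I_n & ~~ in_interval ab i]).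

Section Concatenation.
Variable n : nat.
Implicit Types (x : vertex n) (e f : edge n) (E F H G : network n).

Definition shift_vertex (m : nat) x : vertex n :=
  if x is Inner k then Inner (m + k) else x.

Definition shift_edge (m : nat) e : edge n :=
  Edge (shift_vertex m (edge_tail e)) (shift_vertex m (edge_head e))
    (wire e) (mult e).

Definition ends_at_sink e : bool :=
  if edge_head e is Sink _ then true else false.

Definition starts_at_source e : bool :=
  if edge_tail e is Source _ then true else false.

Definition mergeable e f : bool :=
  match edge_head e, edge_tail f with
  | Sink i, Source j => i == j
  | _, _ => false
  end.

(** Two merged edges lie on the same wire and both have multiplicity 1. *)
Definition merge_edges e f : edge n :=
  Edge (edge_tail e) (edge_head f) (wire e) (mult e).

Definition concatenation E F : network n :=
  let F_edges := [seq shift_edge (inner_count E) f | f <- edges F] in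
  Network (inner_count E + inner_count F)
    ([seq e <- edges E | ~~ ends_at_sink e] ++
     [seq merge_edges ef.1 ef.2 |
        ef <- [seq (e, f) | e <- edges E, f <- F_edges]
        & mergeable ef.1 ef.2] ++
     [seq f <- F_edges | ~~ starts_at_source f]).

Definition parallel e f : bool :=
  (edge_tail e == edge_tail f) && (edge_head e == edge_head f).

Definition joins_inner e : bool :=
  match edge_tail e, edge_head e with
  | Inner _, Inner _ => true
  | _, _ => false
  end.

(** The single edge replacing p > 1 parallel edges is drawn in place of any one
    of them, the edge selected by keep.  In a star network, these p edges all
    have multiplicity 1, so that the total multiplicity is p. *)
Definition condense_edge H e : edge n :=
  if joins_inner e then
    Edge (edge_tail e) (edge_head e) (wire e)
      (\sum_(f <- edges H | parallel e f) mult f)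
  else e.

Definition condensation H G : Prop :=
  exists keep : pred (edge n),
    [/\ forall e, e \in edges H -> ~~ joins_inner e -> keep e,
        forall e, e \in edges H -> joins_inner e ->
          exists! f, [/\ f \in edges H, parallel e f & keep f]
      & G = Network (inner_count H)
              [seq condense_edge H e | e <- edges H & keep e]].

End Concatenation.

(** star_network ivs F: F is a star network F_[a_1,b_1] ... F_[a_m,b_m], where
    ivs is the sequence of the intervals [a_1,b_1], ..., [a_m,b_m]. *)
Inductive star_network (n : nat) : seq (nat * nat) -> network n -> Prop :=
  | StarSimple ab :
      subinterval n ab -> star_network [:: ab] (simple_star n ab)
  | StarConcatenation ivs jvs E F :
      star_network ivs E -> star_network jvs F ->
      star_network (ivs ++ jvs) (concatenation E F)
  | StarCondensedConcatenation ivs jvs E F G :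
      star_network ivs E -> star_network jvs F ->
      condensation (concatenation E F) G ->
      star_network (ivs ++ jvs) G.

Section Paths.
Variable n : nat.
Implicit Types (F : network n) (x y : vertex n) (p q : seq (edge n)).

Fixpoint walk x p y : bool :=
  if p is e :: p' then (edge_tail e == x) && walk (edge_head e) p' y
  else x == y.

Definition is_path F (i j : 'I_n) p : bool :=
  all (mem (edges F)) p && walk (Source i) p (Sink j).

(** The position of x in the path p, as the index of the edge entering x. *)
Definition position p x : nat := index x [seq edge_head e | e <- p].

Definition visits p x : bool := x \in [seq edge_head e | e <- p].

Definition entering p x : option (edge n) :=
  ohead [seq e <- p | edge_head e == x].

(** The part of p that starts at x. *)
Definition path_from p x : seq (edge n) := drop (position p x).+1 p.

(** The interior vertices visited by p strictly before x. *)
Definition vertices_before p x : seq (vertex n) :=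
  take (position p x) [seq edge_head e | e <- p].

(** The network being acyclic, a common vertex x of p and q is the initial
    vertex of a component of their intersection exactly when p and q enter x by
    different edges. *)
Definition meet p q x : bool :=
  [&& visits p x, visits q x & entering p x != entering q x].

Definition enters_below p q x : bool :=
  match entering p x, entering q x with
  | Some e, Some f => wire e < wire f
  | _, _ => false
  end.

(** Given the parts of two paths starting at a common vertex, the first edges
    in which they differ are those by which the paths exit the last vertex of
    the component of their intersection containing that vertex. *)
Fixpoint exits_below p q : bool :=
  match p, q with
  | e :: p', f :: q' => if e == f then exits_below p' q' else wire e < wire f
  | _, _ => false
  end.

(** p and q cross in the component of their intersection with initial vertex x *)
Definition crossing p q x : bool :=
  meet p q x &&
  (enters_below p q x != exits_below (path_from p x) (path_from q x)).

Definition crossings_before p q x : nat :=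
  count (crossing p q) (vertices_before p x).

Definition path_family := 'I_n -> seq (edge n).
Implicit Type pi : path_family.

Definition has_type F (v : {perm 'I_n}) pi : Prop :=
  forall i, is_path F i (v i) (pi i).

Definition covers F pi : Prop :=
  forall e, e \in edges F -> #|[set i | e \in pi i]| = mult e.

Definition defect pi (i j : 'I_n) (k : nat) : bool :=
  [&& i < j, meet (pi i) (pi j) (Inner k)
    & odd (crossings_before (pi i) (pi j) (Inner k))].

Definition dfct F pi : nat :=
  #|[set t : 'I_n * 'I_n * 'I_(inner_count F) | defect pi t.1.1 t.1.2 t.2]|.

(** pi belongs to the set Pi_{v,d}(F) *)
Definition Pi F (v : {perm 'I_n}) (d : nat) pi : Prop :=
  [/\ has_type F v pi, covers F pi & dfct F pi = d].

End Paths.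

(* Main.v *)
Require Import Defs.
From mathcomp Require Import all_boot all_fingroup.
From mathcomp Require Import zify.

(** Following the wires, a covering path family is a sequence of assignments of
    the n paths to the wires, one between any two consecutive stars, where the
    star x_k only permutes the paths lying in its interval.  Two paths meeting
    at x_k form a defect there exactly when they enter x_k in the order opposite
    to that of their sources, so the defects at x_k are the inversions of the
    sequence of wires by which the paths enter x_k.

    Such an inverted pair has met at an earlier x_s; exchanging the two paths
    between x_s and x_k keeps the type, the covering and everything after x_k.
    When no entering path has its index strictly between those of the pair, the
    exchange destroys exactly one defect at x_k, while the number of defects
    before x_k becomes arbitrary.  Applied at the first x_k with a defect, and
    followed by an induction on k that clears all defects before x_k again, it
    lowers the total number of defects by exactly one. *)

Set Implicit Arguments.
Unset Strict Implicit.
Unset Printing Implicit Defensive.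

(** * Wires in star networks *)

Section Wiring.
Variable n : nat.
Implicit Types (x y : vertex n) (e f g : edge n) (E F G : network n).
Implicit Types (ivs jvs : seq (nat * nat)).

(* The time at which a path reaches x, in a network with m interior vertices:
   x_1, ..., x_m, that is Inner 0, ..., Inner m.-1, are reached at 1, ..., m. *)
Definition rank (m : nat) x : nat :=
  match x with Source _ => 0 | Inner k => k.+1 | Sink _ => m.+1 end.

(* Edges incident to a star lie on wires of its interval, whereas edges drawn
   past the star avoid the interval, whichever parallel edge was kept when
   condensing. *)
Definition wired_edge ivs e : Prop :=
  [/\ rank (size ivs) (edge_tail e) < rank (size ivs) (edge_head e),
      match edge_tail e with
      | Source i => wire e = i
      | Inner k => k < size ivs /\ in_interval (nth (1, 0) ivs k) (wire e)
      | Sink _ => False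
      end,
      match edge_head e with
      | Source _ => False
      | Inner k => k < size ivs /\ in_interval (nth (1, 0) ivs k) (wire e)
      | Sink i => wire e = i
      end
    & forall k, rank (size ivs) (edge_tail e) <= k ->
        k.+1 < rank (size ivs) (edge_head e) ->
        ~~ in_interval (nth (1, 0) ivs k) (wire e)].

Definition overlap (m : nat) e f : bool :=
  (rank m (edge_tail e) < rank m (edge_head f)) &&
  (rank m (edge_tail f) < rank m (edge_head e)).

(* The last condition says that a wire carries at most one edge at a time. *)
Definition wired ivs F : Prop :=
  [/\ inner_count F = size ivs,
      forall e, e \in edges F -> wired_edge ivs e
    & forall e f, e \in edges F -> f \in edges F -> wire e = wire f ->
        overlap (size ivs) e f -> e = f].

Lemma overlapC m e f : overlap m e f = overlap m f e.
Proof. by rewrite /overlap andbC. Qed.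

Lemma wired_simple_star ab : wired [:: ab] (simple_star n ab).
Proof.
have mem_star e : e \in edges (simple_star n ab) ->
    [\/ in_interval ab (wire e) /\
        e = Edge (Source (wire e)) (Inner 0) (wire e) 1,
        in_interval ab (wire e) /\
        e = Edge (Inner 0) (Sink (wire e)) (wire e) 1
      | ~~ in_interval ab (wire e) /\
        e = Edge (Source (wire e)) (Sink (wire e)) (wire e) 1].
  rewrite !mem_cat => /or3P[] /mapP[i]; rewrite mem_filter => /andP[abi _] ->.
  - by apply: Or31.
  - by apply: Or32.
  - by apply: Or33.
split=> //.
- move=> e /mem_star; case: e => x y i p /=.
  by move=> [] [abi [-> -> _]]; split=> // [] [|[|k]].
- move=> e f /mem_star + /mem_star; case: e f => [x y i p] [x' y' i' p'] /=.
  move=> [] [abi [-> -> ->]] [] [abi' [-> -> ->]] /= ii';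
    by move: abi'; rewrite -?ii' ?abi // (negPf abi).
Qed.

Lemma concatenation_edgeP E F g : g \in edges (concatenation E F) ->
  [\/ g \in edges E /\ ~~ ends_at_sink g,
      exists e f i, [/\ e \in edges E, f \in edges F, edge_head e = Sink i,
        edge_tail f = Source i
        & g = Edge (edge_tail e) (shift_vertex (inner_count E) (edge_head f))
                (wire e) (mult e)]
    | exists f, [/\ f \in edges F, ~~ starts_at_source f
        & g = shift_edge (inner_count E) f]].
Proof.
rewrite /= !mem_cat => /or3P[].
- by rewrite mem_filter => /andP[gN Eg]; apply: Or31.
- move=> /mapP[[e f']]; rewrite mem_filter => /andP[/= + /allpairsP[[e0 f0]]].
  rewrite /mergeable => + [/= Ee /mapP[f Ff ->] [ee f'E]].
  rewrite -ee in Ee; subst f'.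
  rewrite /=; case he : (edge_head e) => [//|//|i].
  case tf : (edge_tail f) => [j|j|j] //=.
  move=> /eqP ij ->; subst j.
  by apply: Or32; exists e, f, i.
- rewrite mem_filter => /andP[sf /mapP[f Ff gE]].
  apply: Or33; exists f; split=> //.
  by move: sf; rewrite gE /starts_at_source /=; case: (edge_tail f).
Qed.

Lemma wired_concatenation ivs jvs E F :
  wired ivs E -> wired jvs F -> wired (ivs ++ jvs) (concatenation E F).
Proof.
move=> [szE edgE uniqE] [szF edgF uniqF].
pose r := rank (size (ivs ++ jvs)).
pose rE := rank (size ivs); pose rF := rank (size jvs).
have rtE e : e \in edges E -> r (edge_tail e) = rE (edge_tail e).
  by move=> /edgE[_ + _ _]; case: (edge_tail e).
have rhE e : e \in edges E -> ~~ ends_at_sink e ->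
    r (edge_head e) = rE (edge_head e) /\ rE (edge_head e) <= size ivs.
  by rewrite /ends_at_sink => /edgE[_ _ + _]; case: (edge_head e) => //= k [].
have rtF f : f \in edges F -> ~~ starts_at_source f ->
    r (shift_vertex (size ivs) (edge_tail f)) = size ivs + rF (edge_tail f) /\
    0 < rF (edge_tail f).
  rewrite /starts_at_source => /edgF[_ + _ _].
  by case: (edge_tail f) => //= k; rewrite addnS.
have rhF f : f \in edges F ->
    r (shift_vertex (size ivs) (edge_head f)) = size ivs + rF (edge_head f).
  move=> /edgF[_ _ + _]; rewrite /r.
  by case: (edge_head f) => //= k; rewrite ?size_cat addnS.
have leE e : e \in edges E -> rE (edge_tail e) <= size ivs.
  by move=> /edgE[_ + _ _]; case: (edge_tail e) => //= k [].
have gtF f : f \in edges F -> 0 < rF (edge_head f).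
  by move=> /edgF[_ _ + _]; case: (edge_head f).
have nthL k : k < size ivs -> nth (1, 0) (ivs ++ jvs) k = nth (1, 0) ivs k.
  by move=> ltk; rewrite nth_cat ltk.
have nthR k : nth (1, 0) (ivs ++ jvs) (size ivs + k) = nth (1, 0) jvs k.
  by rewrite nth_cat ltnNge leq_addr addKn.
have inL k w : k < size ivs /\ in_interval (nth (1, 0) ivs k) w ->
    k < size (ivs ++ jvs) /\ in_interval (nth (1, 0) (ivs ++ jvs) k) w.
  by case=> ltk wk; rewrite size_cat nthL // ltn_addr.
have inR k w : k < size jvs /\ in_interval (nth (1, 0) jvs k) w ->
    size ivs + k < size (ivs ++ jvs) /\
    in_interval (nth (1, 0) (ivs ++ jvs) (size ivs + k)) w.
  by case=> ltk wk; rewrite size_cat nthR ltn_add2l.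
split; first by rewrite size_cat -szE -szF.
- move=> g /concatenation_edgeP[[Eg gN] | [e [f [i [Ee Ff ei fi ->]]]]
                               | [f [Ff fN ->]]]; rewrite ?szE.
  + have [lt_g tail_g head_g pass_g] := edgE g Eg.
    have [rh leh] := rhE g Eg gN; have rt := rtE g Eg.
    rewrite /wired_edge -!/(r _) rh rt; split=> //.
    * by case: (edge_tail g) tail_g => // k /inL.
    * by case: (edge_head g) head_g => // k /inL.
    * move=> k lek ltk; rewrite nthL; first exact: pass_g.
      exact: leq_trans (ltnW ltk) leh.
  + have [_ tail_e + pass_e] := edgE e Ee.
    have [_ + head_f pass_f] := edgF f Ff; rewrite fi ei => wf we.
    rewrite /wired_edge /= -!/(r _) rtE // rhF //; split=> //.
    * by rewrite -addn1 leq_add ?leE ?gtF.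
    * by case: (edge_tail e) tail_e => // k /inL.
    * by case: (edge_head f) head_f => //= [k|k]; rewrite we -wf // => /inR.
    * move=> k lek ltk; have [ltk'|lek'] := ltnP k (size ivs).
        by rewrite nthL //; apply: pass_e => //; rewrite ei.
      rewrite -(subnKC lek') nthR we -wf; apply: pass_f; first by rewrite fi.
      by move: ltk; rewrite -/(rF _); lia.
  + have [lt_f tail_f head_f pass_f] := edgF f Ff.
    have [rt gt0] := rtF f Ff fN; have rh := rhF f Ff.
    rewrite /wired_edge /= -!/(r _) rh rt; split.
    * by rewrite ltn_add2l.
    * move: fN; rewrite /starts_at_source.
      by case: (edge_tail f) tail_f => //= k /inR.
    * by case: (edge_head f) head_f => //= k /inR.
    * move=> k lek ltk.
      have lek' : size ivs <= k by apply: leq_trans lek; apply: leq_addr.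
      rewrite -(subnKC lek') nthR; apply: pass_f; rewrite -/(rF _); lia.
have wE e i : e \in edges E -> edge_head e = Sink i -> wire e = i.
  by move=> /edgE[_ _ + _] hE; rewrite hE.
have wF f i : f \in edges F -> edge_tail f = Source i -> wire f = i.
  by move=> /edgF[_ + _ _] hE; rewrite hE.
have ovE g h : overlap (size (ivs ++ jvs)) g h =
    (r (edge_tail g) < r (edge_head h)) && (r (edge_tail h) < r (edge_head g)).
  by [].
have AB e e' y i p : e \in edges E -> ~~ ends_at_sink e ->
    e' \in edges E -> edge_head e' = Sink i -> wire e = wire e' ->
    ~ overlap (size (ivs ++ jvs)) e (Edge (edge_tail e') y (wire e') p).
  move=> Ee eN Ee' e'i ww; rewrite ovE => /andP[/= _].
  have [-> _] := rhE e Ee eN; rewrite rtE // => lt'.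
  have ee' : e = e'.
    by apply: uniqE => //; rewrite /overlap lt' e'i /= ltnS leE.
  by move: eN; rewrite ee' /ends_at_sink e'i.
have BC e f f' x i p : e \in edges E -> edge_head e = Sink i ->
    f \in edges F -> edge_tail f = Source i ->
    f' \in edges F -> ~~ starts_at_source f' -> wire e = wire f' ->
    ~ overlap (size (ivs ++ jvs))
        (Edge x (shift_vertex (size ivs) (edge_head f)) (wire e) p)
        (shift_edge (size ivs) f').
  move=> Ee ei Ff fi Ff' f'N ww; rewrite ovE => /andP[/= _].
  have [-> _] := rtF f' Ff' f'N; rewrite rhF // ltn_add2l => lt'.
  have ff' : f = f'.
    apply: uniqF => //; first by rewrite -ww (wF f i) // (wE e i).
    by rewrite /overlap lt' fi /= gtF.
  by move: f'N; rewrite -ff' /starts_at_source fi.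
have AC e f : e \in edges E -> ~~ ends_at_sink e ->
    f \in edges F -> ~~ starts_at_source f ->
    ~ overlap (size (ivs ++ jvs)) e (shift_edge (size ivs) f).
  move=> Ee eN Ff fN; rewrite ovE => /andP[_ /=].
  have [-> lee] := rhE e Ee eN; have [-> lef] := rtF f Ff fN; lia.
rewrite -szE in AB BC AC.
move=> g g' /concatenation_edgeP[[Eg gN] | [e [f [i [Ee Ff ei fi ->]]]]
                                 | [f [Ff fN ->]]];
move=> /concatenation_edgeP[[Eg' gN'] | [e' [f' [i' [Ee' Ff' ei' fi' ->]]]]
                            | [f' [Ff' fN' ->]]] /= ww.
+ rewrite ovE !rtE // (rhE g _ _).1 // (rhE g' _ _).1 //; exact: uniqE.
+ by move=> /(AB _ _ _ _ _ Eg gN Ee' ei' ww).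
+ by move=> /(AC _ _ Eg gN Ff' fN').
+ by rewrite overlapC => /(AB _ _ _ _ _ Eg' gN' Ee ei (esym ww)).
+ rewrite szE => _.
  have ee' : e = e'.
    by apply: uniqE; rewrite // /overlap ei ei' /= !ltnS !leE.
  have ff' : f = f'.
    apply: uniqF; rewrite // /overlap ?fi ?fi' /= ?gtF //.
    by rewrite (wF f i) // (wF f' i') // -(wE e i) // -(wE e' i').
  by rewrite ee' ff'.
+ by move=> /(BC _ _ _ _ _ _ Ee ei Ff fi Ff' fN' ww).
+ by rewrite overlapC => /(AC _ _ Eg' gN' Ff fN).
+ by rewrite overlapC => /(BC _ _ _ _ _ _ Ee' ei' Ff' fi' Ff fN (esym ww)).
+ rewrite szE ovE /= (rtF f _ _).1 // (rtF f' _ _).1 // !rhF //.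
  rewrite !ltn_add2l => ov.
  by rewrite (uniqF f f').
Qed.

Lemma wired_condensation ivs H G :
  wired ivs H -> condensation H G -> wired ivs G.
Proof.
move=> [szH edgH uniqH] [keep [_ _ ->]].
have condE e : [/\ edge_tail (condense_edge H e) = edge_tail e,
    edge_head (condense_edge H e) = edge_head e
    & wire (condense_edge H e) = wire e].
  by rewrite /condense_edge; case: ifP.
split=> //=.
- move=> g /mapP[e]; rewrite mem_filter => /andP[_ /edgH] + ->.
  by rewrite /wired_edge; have [-> -> ->] := condE e.
- move=> g h /mapP[e He ->] /mapP[f Hf ->]; move: He Hf; rewrite !mem_filter.
  move=> /andP[_ He] /andP[_ Hf]; rewrite /overlap.
  have [-> -> ->] := condE e; have [-> -> ->] := condE f => ww ov.
  by rewrite (uniqH e f).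
Qed.

Lemma wired_star_network ivs F : star_network ivs F -> wired ivs F.
Proof.
elim=> {ivs F}.
- by move=> ab _; apply: wired_simple_star.
- by move=> ivs jvs E F _ wE _ wF; apply: wired_concatenation.
- move=> ivs jvs E F G _ wE _ wF; apply: wired_condensation.
  exact: wired_concatenation.
Qed.
End Wiring.

(** * Inversions of partial sequences *)

Definition inverted (n : nat) (i j : 'I_n) (a b : option 'I_n) : bool :=
  (i < j) &&
  if a is Some w then if b is Some w' then w' < w else false else false.

Definition inversions n (w : 'I_n -> option 'I_n) : {set 'I_n * 'I_n} :=
  [set u | inverted u.1 u.2 (w u.1) (w u.2)].

Lemma inversions_tperm n (w : 'I_n -> option 'I_n) : inversions w != set0 ->
  exists i j, inverted i j (w i) (w j) /\
    #|inversions w| = #|inversions (w \o tperm i j)|.+1.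
Proof.
case/set0Pn=> u0 u0P.
(* The closest inverted pair: no defined value lies strictly between. *)
case: (@arg_minnP _ u0 [in inversions w] (fun u => u.2 - u.1) u0P) => -[i j].
rewrite !inE /= => ijP minij; exists i, j; split=> //.
have /andP[ltij] := ijP.
case wi: (w i) => [a|] //; case wj: (w j) => [b|] // ltba.
have between (h : 'I_n) : i < h -> h < j -> w h = None.
  move=> ltih lthj; case wh: (w h) => [c|] //.
  have iN : ~~ inverted i h (w i) (w h).
    by apply/negP=> ihP; have := minij (i, h); rewrite !inE /= => /(_ ihP); lia.
  have jN : ~~ inverted h j (w h) (w j).
    by apply/negP=> ihP; have := minij (h, j); rewrite !inE /= => /(_ ihP); lia.
  by move: iN jN; rewrite /inverted ltih lthj wi wj wh /=; lia.
rewrite (cardsD1 (i, j)) inE /= ijP add1n; congr S.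
pose tau (u : 'I_n * 'I_n) := (tperm i j u.1, tperm i j u.2).
have tauK : involutive tau by case=> x y; rewrite /tau /= !tpermK.
rewrite -(card_preimset (inversions (w \o tperm i j)) (inv_inj tauK)).
apply: eq_card => -[x y]; rewrite !inE /tau /= !tpermK /inverted xpair_eqE.
case wx: (w x) => [c|] //; last by rewrite !andbF.
case wy: (w y) => [d|] //; last by rewrite !andbF.
have bx : ~~ ((i < x) && (x < j)).
  by apply/negP=> /andP[/between xN /xN]; rewrite wx.
have bY : ~~ ((i < y) && (y < j)).
  by apply/negP=> /andP[/between yN /yN]; rewrite wy.
rewrite -!val_eqE /=; case: tpermP wx; case: tpermP wy => /=.
- by move=> -> + ->; rewrite wi => -[<-] [<-]; lia.
- move=> -> + ->; rewrite wi wj => -[<-] [<-]; lia.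
- by move=> /eqP yi /eqP yj wy -> _; move: yi yj bY; rewrite -!val_eqE /=; lia.
- move=> -> + ->; rewrite wi wj => -[<-] [<-]; lia.
- by move=> -> + ->; rewrite wj => -[<-] [<-]; lia.
- by move=> /eqP yi /eqP yj wy -> _; move: yi yj bY; rewrite -!val_eqE /=; lia.
- by move=> -> _ /eqP xi /eqP xj _; move: xi xj bx; rewrite -!val_eqE /=; lia.
- by move=> -> _ /eqP xi /eqP xj _; move: xi xj bx; rewrite -!val_eqE /=; lia.
- move=> /eqP yi /eqP yj _ /eqP xi /eqP xj _; move: xi xj.
  by rewrite -!val_eqE /=; lia.
Qed.

(** * Paths and defects *)

Section Routes.
Variables (n : nat) (ivs : seq (nat * nat)) (F : network n).
Hypothesis wiredF : wired ivs F.
Implicit Types (e f : edge n) (p q : seq (edge n)).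

Local Notation m := (size ivs).
Local Notation tl e := (rank m (edge_tail e)).
Local Notation hd e := (rank m (edge_head e)).

Definition early r p := [seq e <- p | hd e <= r].
Definition late r p := [seq e <- p | r < hd e].

Lemma walk_cat x p q z :
  walk x (p ++ q) z <-> exists2 y, walk x p y & walk y q z.
Proof.
elim: p x => [|e p IHp] x /=.
  by split=> [wq|[y /eqP ->] //]; exists x.
split=> [/andP[-> /IHp[y wp wq]]|[y /andP[-> wp] wq]]; first by exists y.
by apply/IHp; exists y.
Qed.

Lemma head_innerE k e : k < m -> (edge_head e == Inner k) = (hd e == k.+1).
Proof.
move=> ltk; case: (edge_head e) => [i|l|i] /=; apply/eqP/eqP=> //;
  try by case=> ->.
by case=> mk; move: ltk; rewrite mk ltnn.
Qed.

Lemma walk_path x p y : all (mem (edges F)) p -> walk x p y ->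
  path ltn (rank m x) [seq hd e | e <- p].
Proof.
have [_ edgF _] := wiredF.
elim: p x => //= e p IHp x /andP[/edgF[lte _ _ _] pF].
case/andP=> /eqP <- /(IHp _ pF) ->.
by rewrite lte.
Qed.

Lemma filter_none (T : Type) (a : pred T) (s : seq T) :
  all (predC a) s -> filter a s = [::].
Proof. by elim: s => //= x s IHs /andP[/negPf -> /IHs]. Qed.

Lemma early_late r p a :
  path ltn a [seq hd e | e <- p] -> early r p ++ late r p = p.
Proof.
elim: p a => //= e p IHp a /andP[_ sp]; rewrite (leqNgt (hd e)).
case: ltnP => /= [ltr|_]; last by rewrite (IHp _ sp).
have: all (fun f => r < hd f) p.
  move: (order_path_min ltn_trans sp); rewrite all_map.
  by apply: sub_all => f /=; apply: ltn_trans.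
move=> ltp; rewrite [late r p](all_filterP ltp) [early r p]filter_none //.
by apply: sub_all ltp => f /=; rewrite -ltnNge.
Qed.

Lemma route_cut i j p r : is_path F i j p -> r <= m ->
  exists e p', [/\ p = early r p ++ e :: p', e \in edges F,
    tl e <= r < hd e, all (fun f => hd e < hd f) p'
    & walk (Source i) (early r p) (edge_tail e) /\
      walk (edge_head e) p' (Sink j)].
Proof.
have [_ edgF _] := wiredF.
move=> /andP[pF wp] ler; have sp := walk_path pF wp.
have pE := early_late r sp.
move: (wp); rewrite -{1}pE => /walk_cat[y we].
have lEall : all (fun f => r < hd f) (late r p) by apply: filter_all.
have rky : rank m y <= r.
  have : all (fun f => hd f <= r) (early r p) by apply: filter_all.
  move: (early r p) we (isT : rank m (Source i) <= r) => q.
  elim: q (Source i) => /= [x /eqP -> //|f q IHq x].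
  move=> /andP[_ /IHq wq] _ /andP[lef leq].
  exact: wq.
case lE : (late r p) => [|e p'] /=.
  by move=> /eqP yE; move: rky; rewrite yE /= ltnNge ler.
move=> /andP[/eqP ye wl]; exists e, p'; split=> //.
- by rewrite -lE.
- by apply: (allP pF); rewrite -pE lE mem_cat mem_head orbT.
- by rewrite ye rky /=; move: lEall; rewrite lE /= => /andP[].
- move: sp; rewrite -pE lE map_cat cat_path /= => /andP[_ /andP[_]].
  by move/(order_path_min ltn_trans); rewrite all_map.
- by rewrite ye.
Qed.

Lemma cut_filters r p e p' : p = early r p ++ e :: p' -> r < hd e ->
    all (fun f => hd e < hd f) p' ->
  [/\ late r p = e :: p',
      early r.+1 p = early r p ++ (if hd e == r.+1 then [:: e] else [::]),
      late r.+1 p = if hd e == r.+1 then p' else e :: p'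
    & r < m -> [seq f <- p | edge_head f == Inner r] =
        if hd e == r.+1 then [:: e] else [::]].
Proof.
move=> pE lte ltp.
have lee : all (fun f => hd f <= r) (early r p) by apply: filter_all.
have le1 : all (fun f => hd f <= r.+1) (early r p).
  by apply: sub_all lee => f; apply: leqW.
have ltp' : all (fun f => r.+1 < hd f) p'.
  by apply: sub_all ltp => f; apply: leq_ltn_trans.
have n1 q : all (fun f => r.+1 < hd f) q -> early r.+1 q = [::].
  by move=> qr; apply: filter_none; apply: sub_all qr => f; rewrite /= ltnNge.
have n2 q : all (fun f => r.+1 < hd f) q -> late r.+1 q = q by move/all_filterP.
have n3 : late r (early r p) = [::].
  by apply: filter_none; apply: sub_all lee => f; rewrite /= -leqNgt.
have n4 : late r.+1 (early r p) = [::].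
  by apply: filter_none; apply: sub_all le1 => f; rewrite /= -leqNgt.
have n5 : early r.+1 (early r p) = early r p by apply/all_filterP.
have lcat b s t : late b (s ++ t) = late b s ++ late b t by apply: filter_cat.
have ecat b s t : early b (s ++ t) = early b s ++ early b t.
  exact: filter_cat.
split.
- rewrite {1}pE lcat n3 /= lte; congr cons.
  by apply/all_filterP; apply: sub_all ltp' => f /=; apply: ltnW.
- by rewrite {1}pE ecat n5 /= n1 // eqn_leq lte andbT.
- rewrite {1}pE lcat n4 /= n2 //; case: (ltngtP r.+1 (hd e)) => //.
  by move/(leq_ltn_trans lte); rewrite ltnn.
- move=> ltr; rewrite {1}pE filter_cat /= !filter_none ?head_innerE //=.
  + by apply: sub_all ltp' => f /=; rewrite head_innerE //; lia.
  + by apply: sub_all lee => f /=; rewrite head_innerE //; lia.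
Qed.

Lemma path_from_late r p e p' :
    r < m -> p = early r p ++ e :: p' -> hd e = r.+1 ->
  vertices_before p (Inner r) = [seq edge_head f | f <- early r p] /\
  path_from p (Inner r) = p'.
Proof.
move=> ltr pE he.
have eN : Inner r \notin [seq edge_head f | f <- early r p].
  apply/mapP=> -[f]; rewrite mem_filter => /andP[lef _] rE.
  by move: lef; rewrite -rE ltnn.
have posE : position p (Inner r) = size (early r p).
  have /eqP eE : edge_head e == Inner r by rewrite head_innerE // he.
  rewrite /position {1}pE map_cat index_cat (negPf eN) /= eE eqxx addn0.
  exact: size_map.
rewrite /vertices_before /path_from posE; split.
  by rewrite [in X in take _ X]pE map_cat take_size_cat ?size_map.
by rewrite [in X in drop _ X]pE drop_cat ltnNge leqnSn subSnn /= drop0.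
Qed.

Lemma visitsE p x : visits p x = isSome (entering p x).
Proof.
rewrite /visits /entering; elim: p => //= e p IHp.
by rewrite in_cons eq_sym; case: eqP.
Qed.

Lemma interval_order ab (w w1 w2 : 'I_n) :
    in_interval ab w1 -> in_interval ab w2 -> ~~ in_interval ab w ->
  (w1 < w) = (w2 < w) /\ (w < w1) = (w < w2).
Proof. by rewrite /in_interval; lia. Qed.

Lemma route_early0 i j p : is_path F i j p -> early 0 p = [::].
Proof.
have [_ edgF _] := wiredF => /andP[/allP pF _].
apply: filter_none; apply/allP=> e /pF /edgF[lte _ _ _] /=.
by rewrite -ltnNge (leq_ltn_trans _ lte).
Qed.

Lemma route_first i j p : is_path F i j p ->
  exists e p', late 0 p = e :: p' /\ wire e = i.
Proof.
have [_ edgF _] := wiredF => pP.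
have [e [p' [pE Fe /andP[_ hre] allp' [we _]]]] := route_cut pP (leq0n m).
have [lpE _ _ _] := cut_filters pE hre allp'.
exists e, p'; split=> //; move: we; rewrite (route_early0 pP) /= => /eqP eE.
by have [_ + _ _] := edgF e Fe; rewrite -eE.
Qed.

(* A path passing by the star of rank r.+1 has its wire outside the interval in
   which the other path changes wires, so their order is not affected. *)
Lemma exits_below_pass (i j : 'I_n) e p' f q q' r : r < m -> is_path F i j q ->
    e \in edges F -> tl e <= r -> r.+1 < hd e ->
    f \in edges F -> tl f <= r -> hd f = r.+1 -> late r.+1 q = q' ->
    walk (edge_head f) q' (Sink j) ->
  exits_below (e :: p') q' = exits_below (e :: p') (f :: q') /\
  exits_below q' (e :: p') = exits_below (f :: q') (e :: p').
Proof.
have [_ edgF _] := wiredF.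
move=> ltr qP Fe tre hre Ff trf hf lq1E wq'.
have /eqP fr : edge_head f == Inner r by rewrite head_innerE // hf.
have [g [q2 [qE Fg /andP[trg hrg] allq [_ _]]]] := route_cut qP ltr.
have [lqE _ _ _] := cut_filters qE hrg allq.
rewrite -lq1E lqE /=; move: wq'; rewrite -lq1E lqE fr /= => /andP[/eqP gr _].
have neg : e != g by apply: contraTneq tre => ->; rewrite gr /= ltnn.
have nef : e != f by apply: contraTneq hre => ->; rewrite hf ltnn.
rewrite !(eq_sym _ e) (negPf neg) (negPf nef).
have [_ _ _ pass] := edgF e Fe.
have [_ + _ _] := edgF g Fg; rewrite gr => -[_ gI].
have [_ _ + _] := edgF f Ff; rewrite fr => -[_ fI].
by have [-> ->] := interval_order gI fI (pass r tre hre).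
Qed.

(* exits_below (late r p) (late r q) is the order of the two paths just after
   rank r, read off beyond the component of their intersection, if they are in
   one: a crossing is thus already accounted for at its initial vertex. *)
Lemma parity (i j k l : 'I_n) p q r :
    i < j -> is_path F i k p -> is_path F j l q -> r <= m ->
  odd (count (crossing p q) [seq edge_head e | e <- early r p]) =
  ~~ exits_below (late r p) (late r q).
Proof.
have [_ edgF _] := wiredF.
move=> ltij pP qP; elim: r => [_|r IHr ltr].
  have [e [p' [-> ei]]] := route_first pP.
  have [f [q' [-> fj]]] := route_first qP.
  rewrite (route_early0 pP) /=; case: eqP => [ef|_]; last by rewrite ei fj ltij.
  by move: ltij; rewrite -ei -fj ef ltnn.
have ler := ltnW ltr.
have {}IHr := IHr ler.
have [e [p' [pE Fe /andP[tre hre] allp' [we wp']]]] := route_cut pP ler.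
have [f [q' [qE Ff /andP[trf hrf] allq' [wf wq']]]] := route_cut qP ler.
have [lpE epE lp1E inpE] := cut_filters pE hre allp'.
have [lqE eqE lq1E inqE] := cut_filters qE hrf allq'.
rewrite epE map_cat count_cat oddD IHr lp1E lq1E lpE lqE.
have entp : entering p (Inner r) = if hd e == r.+1 then Some e else None.
  by rewrite /entering inpE //; case: eqP.
have entq : entering q (Inner r) = if hd f == r.+1 then Some f else None.
  by rewrite /entering inqE //; case: eqP.
case: (hd e =P r.+1) entp lp1E => [he|he] entp lp1E; last first.
  rewrite addbF; case: (hd f =P r.+1) entq lq1E => // hf entq lq1E.
  have hre1 : r.+1 < hd e by rewrite ltn_neqAle hre andbT; apply/eqP=> /esym.
  by rewrite (exits_below_pass _ ltr qP Fe tre hre1 Ff trf hf lq1E wq').1.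
have /eqP er : edge_head e == Inner r by rewrite head_innerE // he.
rewrite [count _ _]/= er addn0 oddb.
rewrite /crossing /meet !visitsE /enters_below entp entq.
case: (hd f =P r.+1) entq lq1E => [hf|hf] entq lq1E; last first.
  have hrf1 : r.+1 < hd f by rewrite ltn_neqAle hrf andbT; apply/eqP=> /esym.
  by rewrite addbF (exits_below_pass _ ltr pP Ff trf hrf1 Fe tre he lp1E wp').2.
have [_ ->] := path_from_late ltr pE he.
have [_ ->] := path_from_late ltr qE hf.
rewrite (inj_eq Some_inj) /=; case: eqP => //= _; first by rewrite addbF.
by case: (wire e < wire f); case: exits_below.
Qed.

Lemma route_entering (i j : 'I_n) p k : is_path F i j p -> k < m ->
  if entering p (Inner k) is Some e then
    [/\ e \in edges F, tl e <= k, hd e = k.+1, ohead (late k p) = Some e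
      & vertices_before p (Inner k) = [seq edge_head f | f <- early k p]]
  else True.
Proof.
move=> pP ltk.
have [e [p' [pE Fe /andP[tre hre] allp' _]]] := route_cut pP (ltnW ltk).
have [lpE _ _ inpE] := cut_filters pE hre allp'.
rewrite /entering inpE //; case: eqP => //= he.
split=> //; first by rewrite lpE.
by have [] := path_from_late ltk pE he.
Qed.

Lemma defect_inverted (v : 'I_n -> 'I_n) (pi : path_family n) (i j : 'I_n) k :
    (forall x, is_path F x (v x) (pi x)) -> k < m ->
  defect pi i j k =
  inverted i j (omap (@wire n) (entering (pi i) (Inner k)))
               (omap (@wire n) (entering (pi j) (Inner k))).
Proof.
have [_ _ uniqF] := wiredF.
move=> piP ltk; rewrite /defect /inverted; case: ltnP => //= ltij.
have := route_entering (piP i) ltk; have := route_entering (piP j) ltk.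
rewrite /meet !visitsE /crossings_before.
case ei: (entering (pi i) _) => [e|] //.
case ej: (entering (pi j) _) => [f|] //=.
case=> [Ff tlf hdf lf _] [Fe tle hde le ->].
rewrite (inj_eq Some_inj) (parity ltij (piP i) (piP j) (ltnW ltk)).
case: (late k _) le => //= _ p' [->]; case: (late k _) lf => //= _ q' [->].
case: eqP => [->|ef]; first by rewrite ltnn.
rewrite /= -leqNgt leq_eqVlt; case: eqP => //= fe; case: ef; apply: uniqF => //.
  exact/esym/val_inj.
by rewrite /overlap hde hdf !ltnS tle tlf.
Qed.

Implicit Type pi : path_family n.

Definition swap_segments (i j : 'I_n) s t pi : path_family n := fun x =>
  early s (pi x) ++ late s (early t (pi (tperm i j x))) ++ late t (pi x).

Lemma walk_det (x y z : vertex n) p : walk x p y -> walk x p z -> y = z.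
Proof.
elim: p x => [|e p IHp] x /=; first by move=> /eqP <- /eqP.
by move=> /andP[_ /IHp wy] /andP[_ /wy].
Qed.

Lemma early_early s t p : s <= t -> early s (early t p) = early s p.
Proof.
move=> lest; rewrite /early -filter_predI; apply: eq_filter => e /=.
by rewrite andb_idr // => /leq_trans; apply.
Qed.

Lemma route_early_late i j p r : is_path F i j p ->
  early r p ++ late r p = p.
Proof. by case/andP=> pF /(walk_path pF) /early_late. Qed.

Lemma route_split i j p s t : is_path F i j p -> s <= t ->
  early s p ++ late s (early t p) = early t p.
Proof.
move=> pP lest; have pE := route_early_late t pP.
case/andP: pP => pF /(walk_path pF); rewrite -{1}pE map_cat cat_path.
by case/andP=> /(early_late s) + _; rewrite early_early.
Qed.

Lemma route_split_walk i j p k : is_path F i j p -> k < m ->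
    visits p (Inner k) ->
  walk (Source i) (early k.+1 p) (Inner k) /\
  walk (Inner k) (late k.+1 p) (Sink j).
Proof.
move=> pP ltk; rewrite visitsE /entering.
have [e [p' [pE _ /andP[_ hre] allp' [we wp']]]] := route_cut pP (ltnW ltk).
have [_ epE lp1E inpE] := cut_filters pE hre allp'.
rewrite epE lp1E inpE //; case: eqP => //= he _.
have /eqP er : edge_head e == Inner k by rewrite head_innerE // he.
rewrite -er; split=> //; apply/walk_cat; exists (edge_tail e) => //=.
by rewrite !eqxx.
Qed.

Lemma walk_segment i j p s t : is_path F i j p -> s < t -> t < m ->
    visits p (Inner s) -> visits p (Inner t) ->
  walk (Inner s) (late s.+1 (early t.+1 p)) (Inner t).
Proof.
move=> pP ltst ltt ps pt; have [wt _] := route_split_walk pP ltt pt.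
have [ws _] := route_split_walk pP (ltn_trans ltst ltt) ps.
rewrite -(route_split pP (ltnW ltst : s.+1 <= t.+1)) in wt.
by case/walk_cat: wt => z /(walk_det ws) <-.
Qed.

Lemma mem_swap_segments i j s t pi e x : s <= t ->
  (e \in swap_segments i j s t pi x) =
  if s < hd e <= t then e \in pi (tperm i j x) else e \in pi x.
Proof.
move=> lest; rewrite !mem_cat !mem_filter !(leqNgt (hd e)).
by case: (ltnP s (hd e)); case: (ltnP t (hd e)) => /=; rewrite ?orbF //; lia.
Qed.

Lemma swap_segments_type (v : {perm 'I_n}) pi i j s t :
    has_type F v pi -> s < t -> t < m ->
    visits (pi i) (Inner s) -> visits (pi j) (Inner s) ->
    visits (pi i) (Inner t) -> visits (pi j) (Inner t) ->
  has_type F v (swap_segments i j s.+1 t.+1 pi).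
Proof.
move=> piT ltst ltt si sj ti tj x; apply/andP; split.
  apply/allP=> e; rewrite mem_swap_segments; last exact: ltnW.
  have inF y : e \in pi y -> e \in edges F.
    by have /andP[/allP yF _] := piT y; apply: yF.
  by case: ifP => _ /inF.
rewrite /swap_segments; have [-> | [xs xt ys yt]] :
    tperm i j x = x \/ [/\ visits (pi x) (Inner s), visits (pi x) (Inner t),
      visits (pi (tperm i j x)) (Inner s)
      & visits (pi (tperm i j x)) (Inner t)].
  by case: tpermP => [->|->|_ _]; [right|right|left].
  rewrite catA (route_split (piT x)); last by rewrite ltnS ltnW.
  by rewrite (route_early_late _ (piT x)); case/andP: (piT x).
have [ws _] := route_split_walk (piT x) (ltn_trans ltst ltt) xs.
have [_ wt] := route_split_walk (piT x) ltt xt.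
apply/walk_cat; exists (Inner s) => //; apply/walk_cat; exists (Inner t) => //.
exact: walk_segment (piT (tperm i j x)) ltst ltt ys yt.
Qed.

Lemma swap_segments_covers pi i j s t : s <= t ->
  covers F pi -> covers F (swap_segments i j s t pi).
Proof.
move=> lest pi_cov e Fe; rewrite -(pi_cov e Fe).
transitivity #|[set x | if s < hd e <= t then e \in pi (tperm i j x)
                        else e \in pi x]|.
  by apply: eq_card => x; rewrite !inE mem_swap_segments.
case: (s < hd e <= t) => //.
rewrite -[RHS](card_preimset _ (@perm_inj _ (tperm i j))).
by apply: eq_card => x; rewrite !inE.
Qed.

Lemma late_swap_segments pi i j s t x : s <= t ->
  late t (swap_segments i j s t pi x) = late t (pi x).
Proof.
move=> lest; rewrite /late !filter_cat -!filter_predI [X in X ++ _]filter_none.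
  rewrite cat0s [X in X ++ _]filter_none; last by apply/allP=> e _ /=; lia.
  by apply: eq_filter => e /=; rewrite andbb.
by apply/allP=> e _ /=; lia.
Qed.

Lemma entering_swap_segments pi i j s t x : s <= t -> t < m ->
  entering (swap_segments i j s t.+1 pi x) (Inner t) =
  entering (pi (tperm i j x)) (Inner t).
Proof.
move=> lest ltt; rewrite /entering /late /early !filter_cat -!filter_predI.
rewrite [X in X ++ _]filter_none; last first.
  by apply/allP=> e _ /=; rewrite head_innerE //; lia.
rewrite cat0s [X in _ ++ X]filter_none ?cats0; last first.
  by apply/allP=> e _ /=; rewrite head_innerE //; lia.
by congr ohead; apply: eq_filter => e /=; rewrite head_innerE //; lia.
Qed.

Variable v : {perm 'I_n}.

Definition defects_at pi k := #|[set u : 'I_n * 'I_n | defect pi u.1 u.2 k]|.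

Lemma dfct_sum pi : dfct F pi = \sum_(k < inner_count F) defects_at pi k.
Proof.
rewrite /dfct -sum1dep_card -(pair_big_dep predT
  (fun u (k : 'I_(inner_count F)) => defect pi u.1 u.2 k) (fun _ _ => 1)) /=.
rewrite (exchange_big_dep predT) //=; apply: eq_bigr => k _.
by rewrite sum1dep_card.
Qed.

Lemma defects_atE pi k : has_type F v pi -> k < m -> defects_at pi k =
  #|inversions (fun x => omap (@wire n) (entering (pi x) (Inner k)))|.
Proof.
move=> piT ltk; apply: eq_card => u; rewrite !inE.
exact: (defect_inverted (v := v)).
Qed.

Lemma entering_late p k : k < m ->
  entering p (Inner k) = entering (late k p) (Inner k).
Proof.
move=> ltk; rewrite /entering -filter_predI; congr ohead.
apply: eq_filter => e /=.
by rewrite head_innerE //; lia.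
Qed.

Lemma late_late p k : late k.+1 p = late k.+1 (late k p).
Proof. by rewrite /late -filter_predI; apply: eq_filter => e /=; lia. Qed.

Lemma meet_before pi i j k : has_type F v pi -> k < m -> defect pi i j k ->
  exists s, [/\ s < k, visits (pi i) (Inner s) & visits (pi j) (Inner s)].
Proof.
have [_ edgF _] := wiredF.
move=> piT ltk /and3P[_ /and3P[vi _ _] dij].
have: has (crossing (pi i) (pi j)) (vertices_before (pi i) (Inner k)).
  by rewrite has_count; apply: odd_gt0.
have := route_entering (piT i) ltk; move: vi; rewrite visitsE.
case: entering => //= e _ [_ _ _ _ ->] /hasP[y /mapP[f + ->]].
rewrite mem_filter => /andP[lef fi] /andP[/and3P[vi vj _] _].
have /andP[/allP piF _] := piT i; have [+ _ _ _] := edgF f (piF f fi).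
case: (edge_head f) lef vi vj => //= [s les|h]; last by rewrite ltnNge ltnW.
by exists s.
Qed.

Definition defects_below t pi := \sum_(k < t) defects_at pi k.

Lemma lower_defects t pi : t <= m -> has_type F v pi -> covers F pi ->
    0 < defects_below t pi ->
  exists pi', [/\ has_type F v pi', covers F pi',
    forall x, late t (pi' x) = late t (pi x)
    & defects_below t pi = (defects_below t pi').+1].
Proof.
rewrite /defects_below; elim: t pi => [|t IHt] pi; first by rewrite big_ord0.
move=> ltt piT piC; rewrite big_ord_recr /=.
have same pi1 pi2 : has_type F v pi1 -> has_type F v pi2 ->
    (forall x, late t (pi1 x) = late t (pi2 x)) ->
    defects_at pi1 t = defects_at pi2 t /\
    (forall x, late t.+1 (pi1 x) = late t.+1 (pi2 x)).
  move=> T1 T2 eq12; split; last by move=> x; rewrite late_late eq12 -late_late.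
  rewrite !defects_atE //; apply: eq_card => u; rewrite !inE.
  by rewrite !(entering_late (pi1 _)) // !(entering_late (pi2 _)) // !eq12.
have [D0 | D1 _] := posnP (\sum_(k < t) defects_at pi k); last first.
  have [pi' [T' C' L' ->]] := IHt pi (ltnW ltt) piT piC D1.
  have [dE lE] := same _ _ T' piT L'.
  by exists pi'; split=> //; rewrite big_ord_recr /= dE.
have clear_below d pi1 : has_type F v pi1 -> covers F pi1 ->
    \sum_(k < t) defects_at pi1 k = d ->
  exists pi2, [/\ has_type F v pi2, covers F pi2,
    forall x, late t (pi2 x) = late t (pi1 x)
    & \sum_(k < t) defects_at pi2 k = 0].
  elim: d pi1 => [|d IHd] pi1 T1 C1 dE; first by exists pi1.
  have := IHt pi1 (ltnW ltt) T1 C1; rewrite dE => -[] // pi2 [T2 C2 L2 [d2]].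
  have [pi3 [T3 C3 L3 d3]] := IHd pi2 T2 C2 (esym d2).
  by exists pi3; split=> // x; rewrite L3.
rewrite D0 add0n defects_atE // card_gt0 => /inversions_tperm[i [j [ijP ->]]].
have dij : defect pi i j t by rewrite (defect_inverted _ _ piT).
have [s [ltst si sj]] := meet_before piT ltt dij.
have /and3P[_ /and3P[ti tj _] _] := dij.
have T' := swap_segments_type piT ltst ltt si sj ti tj.
have C' := swap_segments_covers i j (ltnW ltst : s.+1 <= t.+1) piC.
have [pi2 [T2 C2 L2 d2]] := clear_below _ _ T' C' erefl.
have [dE lE] := same _ _ T2 T' L2.
exists pi2; split=> //.
  by move=> x; rewrite lE late_swap_segments ?ltnS 1?ltnW.
rewrite big_ord_recr /= d2 add0n dE defects_atE //; congr S.
by apply: eq_card => u; rewrite !inE /= !entering_swap_segments.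
Qed.

Lemma lower_dfct pi c : has_type F v pi -> covers F pi -> c <= dfct F pi ->
  exists pi', Pi F v c pi'.
Proof.
have [mE _ _] := wiredF.
move=> piT piC lec; rewrite -(subKn lec); move: (_ - c) => d.
elim: d => [|d [pi' [T' C' d']]]; first by exists pi; rewrite subn0.
have [d0|gt0] := posnP (dfct F pi - d); first by exists pi'; split=> //; lia.
have := gt0; rewrite -{1}d' dfct_sum mE.
case/(lower_defects (leqnn m) T' C') => pi2 [T2 C2 _].
rewrite /defects_below -mE -!dfct_sum d' => d2.
by exists pi2; split=> //; lia.
Qed.
End Routes.

Theorem theorem4p9 (n : nat) (ivs : seq (nat * nat)) (F : network n)
    (star_F : star_network ivs F) (v : {perm 'I_n}) (d : nat) (d_ge1 : 1 <= d) :
  (exists pi : path_family n, Pi F v d pi) ->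
  forall c : nat, c < d -> exists pi : path_family n, Pi F v c pi.
Proof.
case=> pi [piT piC piD] c ltcd.
apply: (lower_dfct (wired_star_network star_F) piT piC).
by rewrite piD ltnW.
Qed.
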